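(* Let $D\ge1$ be an integer and let $\boldsymbol\theta\in\Theta^K$ with $\Theta=\mathbb R$. The expected stopping time of any $\delta$-PAC algorithm (with delays constrained by $D$) satisfies $$\mathbb E_{\boldsymbol\theta}[\tau_\delta]=\Omega\left(\frac{1}{T_D(\boldsymbol\theta)}\log\left(\frac1\delta\right)\right)\quad\text{as }\delta\to0,$$ where $$T_D(\boldsymbol\theta)=\sup_{\nu\in\Sigma_D(\boldsymbol\theta)}\ \inf_{\boldsymbol\theta'\in\mathrm{ALT}(\boldsymbol\theta)}\ \sum_{(\boldsymbol s,\boldsymbol d)\in\mathbb S_D}\sum_{a=1}^K\nu(\boldsymbol s,\boldsymbol d,a)\,\mathrm{KL}\big(Q_{\boldsymbol\theta,D}(\cdot\mid\boldsymbol s,\boldsymbol d,a)\,\big\|\,Q_{\boldsymbol\theta',D}(\cdot\mid\boldsymbol s,\boldsymbol d,a)\big).$$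
   Context: **Model.** $[K]=\{1,\dots,K\}$, $\mathcal S=\{0,1,\dots,S\}$, and $f:\mathcal S\to[0,\infty)$ is a fixed (service delay) function with $\bar f=\max_s f(s)$, $\underline f=\min_s f(s)$, $\mathcal S_{\bar f}=\{s:f(s)=\bar f\}$, $\mathcal S_{\underline f}=\{s:f(s)=\underline f\}$. $P$ is a fixed irreducible stochastic matrix on $\mathcal S$ such that: the submatrix of $P$ on $\mathcal S_{\bar f}$ is irreducible; for every $s\notin\mathcal S_{\bar f}$ there is $s'\in\mathcal S_{\bar f}$ with $P(s'|s)>0$; and the same two conditions hold with $\mathcal S_{\underline f}$ in place of $\mathcal S_{\bar f}$. For $\theta\in\mathbb R$ let $\tilde P_\theta(s'|s)=P(s'|s)e^{\theta f(s')}$, let $\rho(\theta)$ be its Perron–Frobenius eigenvalue with positive right eigenvector $v_\theta$, and let $P_\theta(s'|s)=\frac{v_\theta(s')}{\rho(\theta)v_\theta(s)}\tilde P_\theta(s'|s)$, an irreducible stochastic matrix with stationary distribution $\mu_\theta$. An instance is $\boldsymbol\theta\in\mathbb R^K$. The states $X_{a,n}$ of the arms $a\in[K]$ are independent Markov chains with transition matrices $P_{\theta_a}$; every arm makes one transition per update $n$, whether selected or not (restless). At update $n$ one arm $A_n$ is selected, and $Y_n=f(X_{A_n,n})$ is observed; the observation is identified with the state of the selected arm (deterministic emission). **Best arm.** $g_\theta(\gamma)=\sum_s(\frac12 f(s)^2-\gamma f(s))\mu_\theta(s)+\sum_{s,s'}f(s)f(s')P_\theta(s'|s)\mu_\theta(s)$.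 The real number $\gamma$ is fixed, and $a^*(\boldsymbol\theta)=a^*(\boldsymbol\theta,\gamma)=\arg\min_{a\in[K]}g_{\theta_a}(\gamma)$, assumed to be unique. $\mathrm{ALT}(\boldsymbol\theta)$ is the set of instances $\boldsymbol\theta'$ with $a^*(\boldsymbol\theta')\ne a^*(\boldsymbol\theta)$. **Algorithms.** With $\mathcal F_n=\sigma(A_1,Y_1,\dots,A_n,Y_n)$, an algorithm is a triple of a sampling rule ($A_n$ is $\mathcal F_{n-1}$-measurable), a stopping time $\tau$ with respect to $(\mathcal F_n)$, and an $\mathcal F_\tau$-measurable decision $a_\tau\in[K]$. It is $\delta$-PAC if, for every instance $\boldsymbol\theta$, $\mathbb P_{\boldsymbol\theta}(\tau<\infty)=1$ and $\mathbb P_{\boldsymbol\theta}(a_\tau\ne a^*(\boldsymbol\theta))\le\delta$; then $\tau_\delta$ denotes its stopping time. Each arm is selected once during the first $K$ updates. **Delays.** For $n>K$, $d_a(n)\ge1$ is the number of updates elapsed since arm $a$ was last selected, and $s_a(n)$ is the state of arm $a$ observed at that last selection; $\boldsymbol d(n)=(d_1(n),\dots,d_K(n))$ and $\boldsymbol s(n)=(s_1(n),\dots,s_K(n))$. $\mathbb S$ is the set of all possible values of $(\boldsymbol s(n),\boldsymbol d(n))$, and $\mathbb S_D\subset\mathbb S$ is the finite subset with all delays at most $D$. The delay of each arm is constrained by $D$: the algorithms considered satisfy $(\boldsymbol s(n),\boldsymbol d(n))\in\mathbb S_D$ for all $n>K$. **Kernel.** $Q_{\boldsymbol\theta,D}(\boldsymbol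 s',\boldsymbol d'\mid\boldsymbol s,\boldsymbol d,a)=P_{\theta_a}^{d_a}(s'_a\mid s_a)$ if $d'_a=1$ and, for all $a'\ne a$, $d'_{a'}=d_{a'}+1$ and $s'_{a'}=s_{a'}$; it equals $0$ otherwise. Here $P_{\theta}^{d}$ is the $d$-step transition matrix. $\Sigma_D(\boldsymbol\theta)$ is the set of all probability mass functions $\nu$ on $\mathbb S_D\times[K]$. $\mathrm{KL}$ is the Kullback–Leibler divergence. **Asymptotics.** $\Omega$ as $\delta\to0$ means: there are $C>0$ and $\delta_0>0$, independent of $\delta$ and of the algorithm, such that for all $\delta\in(0,\delta_0)$ the expectation is at least $C$ times the displayed quantity. *)

(* Defs.v *)
From HB Require Import structures.
From mathcomp Require Import all_boot all_order all_algebra.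
From mathcomp Require Import all_classical all_reals all_analysis.
From mathcomp Require Import complex.
Set Implicit Arguments.
Unset Strict Implicit.
Unset Printing Implicit Defensive.
Import Order.TTheory GRing.Theory Num.Theory.
Import numFieldNormedType.Exports.
Local Open Scope classical_set_scope.
Local Open Scope ring_scope.

(* Matrices act on the right of row vectors: the transition probability from
   i to j, written M(j|i) in kernel notation, is the entry [M i j]. *)
Section Matrices.
Variable R : realType.

Definition prob_row (n : nat) (p : 'rV[R]_n) : Prop :=
  (forall i, 0 <= p 0 i) /\ \sum_i p 0 i = 1.

Definition stochastic (n : nat) (M : 'M[R]_n) : Prop :=
  (forall i j, 0 <= M i j) /\ (forall i, \sum_j M i j = 1).

(* The exponent is required to be positive, so the 1 x 1 zero matrix is not
   irreducible. *)
Definition irreducible_mx (n : nat) (M : 'M[R]_n) : Prop :=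
  forall i j, exists2 k : nat, (0 < k)%N & 0 < (M ^+ k) i j.

Definition submx_on (n : nat) (B : {set 'I_n}) (M : 'M[R]_n) : 'M[R]_#|B| :=
  mxsub (@enum_val _ (mem B)) (@enum_val _ (mem B)) M.

Definition irreducible_attracting (n : nat) (M : 'M[R]_n) (B : {set 'I_n}) :
    Prop :=
  irreducible_mx (submx_on B M) /\
  (forall s, s \notin B -> exists2 s', s' \in B & 0 < M s s').

(* [r] is a positive eigenvalue of maximal modulus among all complex
   eigenvalues, with the entrywise positive right eigenvector [v]. *)
Definition perron_frobenius (n : nat) (M : 'M[R]_n) (r : R) (v : 'cV[R]_n) :
    Prop :=
  [/\ 0 < r,
      forall i, 0 < v i 0,
      M *m v = r *: v &
      forall z : R[i],
        eigenvalue (map_mx (real_complex R) M) z -> `|z| <= real_complex R r].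

Definition stationary (n : nat) (M : 'M[R]_n) (m : 'rV[R]_n) : Prop :=
  prob_row m /\ m *m M = m.

End Matrices.

Section Family.
Variables (R : realType) (S : nat) (f : 'I_S.+1 -> R).

Definition max_states : {set 'I_S.+1} :=
  [set s | f s == \big[Num.max/f ord0]_t f t]%SET.

Definition min_states : {set 'I_S.+1} :=
  [set s | f s == \big[Num.min/f ord0]_t f t]%SET.

Definition tilted (P : 'M[R]_S.+1) (t : R) : 'M[R]_S.+1 :=
  \matrix_(s, s') (P s s' * expR (t * f s')).

Definition twisted (P : 'M[R]_S.+1) (rho : R -> R) (v : R -> 'cV[R]_S.+1)
    (t : R) : 'M[R]_S.+1 :=
  \matrix_(s, s') (v t s' 0 / (rho t * v t s 0) * tilted P t s s').

(* [Pt] is the family of transition matrices and [mu] that of stationary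
   distributions, both indexed by the real parameter of an arm. *)
Definition arm_cost (Pt : R -> 'M[R]_S.+1) (mu : R -> 'rV[R]_S.+1)
    (gamma t : R) : R :=
  \sum_s (2^-1 * f s ^+ 2 - gamma * f s) * mu t 0 s +
  \sum_s \sum_s' f s * f s' * Pt t s s' * mu t 0 s.

(* Stated relationally, since the minimizer may fail to be unique for some
   parameter vectors: [best_arm g theta a] says that [a] is the unique
   minimizer of the costs. *)
Definition best_arm (K : nat) (g : R -> R) (theta : 'I_K -> R) (a : 'I_K) :
    Prop :=
  [set b | forall c, g (theta b) <= g (theta c)] = [set a].

Definition ALT (K : nat) (g : R -> R) (theta : 'I_K -> R) :
    set ('I_K -> R) :=
  [set theta' | exists a a', [/\ best_arm g theta a, best_arm g theta' a'
                                & a' <> a]].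

End Family.

(* Updates are numbered from 1; the value of a selection sequence at 0 is never
   used. *)
Section Delays.
Variables K S : nat.

Definition explores (A : nat -> 'I_K) : Prop :=
  forall a, exists! n : nat, (1 <= n <= K)%N /\ A n = a.

(* Meaningful once [a] has been selected strictly before update [n]. *)
Definition last_selection (A : nat -> 'I_K) (n : nat) (a : 'I_K) : nat :=
  (\max_(m < n | (0 < m)%N && (A m == a)) m)%N.

Definition delay (A : nat -> 'I_K) (n : nat) (a : 'I_K) : nat :=
  (n - last_selection A n a)%N.

Definition last_state (A : nat -> 'I_K) (x : 'I_K -> nat -> 'I_S.+1) (n : nat)
    (a : 'I_K) : 'I_S.+1 :=
  x a (last_selection A n a).

(* The possible values of the pair (last observed states, delays), over all
   selection sequences and all trajectories of the arms. *)
Definition possible (s : 'I_K -> 'I_S.+1) (d : 'I_K -> nat) : Prop :=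
  exists (A : nat -> 'I_K) (x : 'I_K -> nat -> 'I_S.+1) (n : nat),
    [/\ explores A, (K < n)%N, s = last_state A x n & d = delay A n].

Definition dstate (D : nat) : finType :=
  ({ffun 'I_K -> 'I_S.+1} * {ffun 'I_K -> 'I_D.+1})%type.

Definition possible_upto (D : nat) : {set dstate D} :=
  [set z : dstate D | `[< possible z.1 (fun a => z.2 a : nat) >]]%SET.

End Delays.

Section Information.
Variables (R : realType) (K S : nat).

Definition KL (T : finType) (p q : T -> R) : \bar R :=
  (\sum_x (if p x == 0%R then 0
           else if q x == 0%R then +oo
           else (p x * ln (p x / q x))%:E))%E.

(* From a state with delays at most [D], the arms that are not selected reach
   delays at most [D.+1], so the kernel is a pmf on [dstate K S D.+1]; it is
   not truncated to delays at most [D]. *)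
Definition Qkernel (Pt : R -> 'M[R]_S.+1) (D : nat) (theta : 'I_K -> R)
    (z : dstate K S D) (a : 'I_K) (z' : dstate K S D.+1) : R :=
  if ((z'.2 a : nat) == 1%N) &&
     [forall b, (b != a) ==>
        ((z'.2 b : nat) == (z.2 b).+1) && (z'.1 b == z.1 b)]
  then (Pt (theta a) ^+ (z.2 a : nat)) (z.1 a) (z'.1 a)
  else 0.

Definition Sigma (D : nat) : set (dstate K S D -> 'I_K -> R) :=
  [set nu | [/\ forall z a, 0 <= nu z a,
                forall z a, z \notin possible_upto K S D -> nu z a = 0 &
                \sum_(z in possible_upto K S D) \sum_a nu z a = 1]].

Definition T_D (Pt : R -> 'M[R]_S.+1) (g : R -> R) (D : nat)
    (theta : 'I_K -> R) : \bar R :=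
  ereal_sup [set
    ereal_inf [set
      (\sum_(z in possible_upto K S D) \sum_(a < K)
         (nu z a)%:E * KL (Qkernel Pt theta z a) (Qkernel Pt theta' z a))%E
      | theta' in ALT g theta]
    | nu in @Sigma D].

End Information.

Section Bandit.
Variables (R : realType) (K S : nat) (dO : measure_display)
  (Omega : measurableType dO).

(* Under each [Pr theta], the K state processes are independent Markov chains;
   the initial law [phi a] of arm [a] at time 0 does not depend on the
   instance. *)
Definition restless_model (Pt : R -> 'M[R]_S.+1) (phi : 'I_K -> 'rV[R]_S.+1)
    (Pr : ('I_K -> R) -> probability Omega R)
    (X : 'I_K -> nat -> Omega -> 'I_S.+1) : Prop :=
  [/\ forall a, prob_row (phi a),
      forall a n s, measurable [set w | X a n w = s] &
      forall (theta : 'I_K -> R) (n : nat) (x : 'I_K -> nat -> 'I_S.+1),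
        Pr theta [set w | forall a i, (i <= n)%N -> X a i w = x a i] =
        (\prod_a (phi a 0 (x a 0%N) *
           \prod_(i < n) Pt (theta a) (x a i) (x a i.+1)))%:E].

(* [stop w = None] stands for an infinite stopping time. *)
Record algorithm := Algorithm {
  arm : nat -> Omega -> 'I_K ;
  stop : Omega -> option nat ;
  decision : Omega -> 'I_K }.

Variable X : 'I_K -> nat -> Omega -> 'I_S.+1.

(* The observation at update [m] is identified with the state of the selected
   arm. *)
Definition history (A : nat -> Omega -> 'I_K) (n : nat) : set (set Omega) :=
  <<s [set E | exists m : nat, (1 <= m <= n)%N /\
        ((exists a, E = [set w | A m w = a]) \/
         (exists s, E = [set w | X (A m w) m w = s]))] >>.

Definition stopped_by (tau : Omega -> option nat) (n : nat) : set Omega :=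
  [set w | exists2 m : nat, tau w = Some m & (m <= n)%N].

Definition stopped_history (A : nat -> Omega -> 'I_K)
    (tau : Omega -> option nat) : set (set Omega) :=
  [set E | measurable E /\ forall n, history A n (E `&` stopped_by tau n)].

Definition admissible (alg : algorithm) : Prop :=
  [/\ forall n a, history (arm alg) n [set w | arm alg n.+1 w = a],
      forall n, history (arm alg) n (stopped_by (stop alg) n),
      forall a, stopped_history (arm alg) (stop alg)
                  [set w | decision alg w = a] &
      forall w, explores (fun n => arm alg n w)].

Definition delay_constrained (D : nat) (alg : algorithm) : Prop :=
  forall (w : Omega) (n : nat), (K < n)%N ->
    exists2 z : dstate K S D, z \in possible_upto K S D &
      forall a,
        z.1 a = last_state (fun m => arm alg m w) (fun b m => X b m w) n a /\
        (z.2 a : nat) = delay (fun m => arm alg m w) n a.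

Definition delta_PAC (Pr : ('I_K -> R) -> probability Omega R) (g : R -> R)
    (delta : R) (alg : algorithm) : Prop :=
  forall (theta : 'I_K -> R) (a : 'I_K), best_arm g theta a ->
    Pr theta [set w | stop alg w <> None] = 1%E /\
    (Pr theta [set w | decision alg w <> a] <= delta%:E)%E.

Definition expected_stop (Pr : probability Omega R) (alg : algorithm) :
    \bar R :=
  (\int[Pr]_w (if stop alg w is Some n then (n%:R : R)%:E else +oo))%E.

End Bandit.

(* Main.v *)
(* A lower bound by change of measure. Condition on the observations only: the
   law of a history is then a product of kernels, because the conditional law of
   the state of an arm is a row of a power of its transition matrix, the exponent
   being its delay. For theta' in ALT, replacing theta by theta' up to the
   stopping time changes the probability of deciding for the best arm of theta
   from at least 1/2 to at most delta, so the expected log-likelihood ratio at the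
   stopping time is at least (1/2) ln(1/delta) - 1. This ratio is a sum over
   updates of divergences of observation kernels. By convexity each of them,
   including those of the exploration phase that involve the initial law, is at
   most the sum B(theta') of all divergences of Q over the possible states and
   the arms. Hence E[tau] B(theta') >= (1/2) ln(1/delta) - 1, and the uniform
   choice of nu shows that T_D is at least the infimum of B(theta') divided by
   the number of pairs of a possible state and an arm. *)
Require Import Defs.
From HB Require Import structures.
From mathcomp Require Import all_boot all_order all_algebra.
From mathcomp Require Import all_classical all_reals all_analysis.
From mathcomp Require Import perm measurable_realfun zify ring lra.
Import Order.TTheory GRing.Theory Num.Theory.
Import numFieldNormedType.Exports.
Local Open Scope classical_set_scope.
Local Open Scope ring_scope.
Set Implicit Arguments.
Unset Strict Implicit.
Unset Printing Implicit Defensive.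

(** * Divergence of nonnegative vectors and the log-sum inequality *)

Section LogRatios.
Variable R : realType.

Lemma ln_le_subr1 (x : R) : 0 < x -> ln x <= x - 1.
Proof.
by move=> x0; have := @le_ln1Dx R (x - 1); rewrite (addrC 1) subrK; apply; lra.
Qed.

(** A real-valued divergence, faithful only when [p] and [q] have the same zeros; [KL_Qkernel] links
    it to [KL]. *)
Definition log_ratio_sum (I : finType) (p q : I -> R) : R :=
  \sum_i p i * ln (p i / q i).

(** Termwise, [ln x <= x - 1] is applied at [x = q i * (a / b) / p i]; the corrections
    [p i - q i * (a / b)] sum to zero. *)
Lemma log_sum_ineq (I : finType) (p q : I -> R) :
  (forall i, 0 <= p i) -> (forall i, 0 <= q i) ->
  (forall i, (p i == 0) = (q i == 0)) ->
  (\sum_i p i) * ln ((\sum_i p i) / (\sum_i q i)) <= log_ratio_sum p q.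
Proof.
move=> p0 q0 pq; set a := \sum_i p i; set b := \sum_i q i.
have [az|an] := eqVneq a 0.
  rewrite az mul0r /log_ratio_sum big1// => i _.
  by rewrite (psumr_eq0P _ az)// ?mul0r// => j _; exact: p0.
have a_gt0 : 0 < a by rewrite lt_def an sumr_ge0.
have b_gt0 : 0 < b.
  rewrite lt_def sumr_ge0// andbT; apply: contraNneq an => /psumr_eq0P bz.
  by rewrite /a big1// => i _; apply/eqP; rewrite pq bz.
have step i : p i * ln (a / b) + (p i - q i * (a / b)) <= p i * ln (p i / q i).
  have [pz|pn] := eqVneq (p i) 0.
    have /eqP-> : q i == 0 by rewrite -pq pz.
    by rewrite pz !mul0r subrr addr0.
  have p_gt0 : 0 < p i by rewrite lt_def pn p0.
  have q_gt0 : 0 < q i by rewrite lt_def -pq pn q0.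
  have r_gt0 : 0 < q i * (a / b) / p i by rewrite !(mulr_gt0, divr_gt0, invr_gt0).
  have -> : ln (p i / q i) = ln (a / b) - ln (q i * (a / b) / p i).
    rewrite -ln_div ?posrE ?r_gt0 ?divr_gt0//; congr (ln _).
    by field; rewrite !gt_eqF.
  rewrite mulrBr lerD2l.
  have := ln_le_subr1 r_gt0; rewrite -(ler_pM2l p_gt0) mulrBr mulr1.
  have -> : p i * (q i * (a / b) / p i) = q i * (a / b).
    by field; rewrite !gt_eqF.
  by lra.
have : \sum_i (p i * ln (a / b) + (p i - q i * (a / b))) <= log_ratio_sum p q.
  exact: ler_sum.
rewrite big_split/= sumrB -!mulr_suml -/a -/b [b * _]mulrCA divff ?gt_eqF//.
by rewrite mulr1 subrr addr0.
Qed.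

Lemma log_ratio_sum_ge0 (I : finType) (p q : I -> R) :
  (forall i, 0 <= p i) -> (forall i, 0 <= q i) ->
  (forall i, (p i == 0) = (q i == 0)) ->
  \sum_i p i = 1 -> \sum_i q i = 1 -> 0 <= log_ratio_sum p q.
Proof.
move=> p0 q0 pq p1 q1; have := log_sum_ineq p0 q0 pq.
by rewrite p1 q1 divr1 ln1 mulr0.
Qed.

End LogRatios.

(** * Change of measure on finite trees of observations *)

Section TreeMeasures.
Variables (R : realType) (T : finType).
Implicit Types (y : seq T) (s : T) (F : seq T -> R).

(* Histories are listed with the most recent observation first. *)
Fixpoint hist n : seq (seq T) :=
  if n is m.+1 then [seq s :: y | y <- hist m, s <- index_enum T] else [:: [::]].

Lemma size_hist n y : y \in hist n -> size y = n.
Proof.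
elim: n y => [|n IH] y /=; first by rewrite inE => /eqP->.
by move=> /allpairsP[[z s] /= [/IH <- _ ->]].
Qed.

Lemma big_hist n F :
  \sum_(y <- hist n.+1) F y = \sum_(y <- hist n) \sum_s F (s :: y).
Proof. by rewrite /= big_allpairs_dep. Qed.

Fixpoint tree_prob (k : seq T -> T -> R) y : R :=
  if y is s :: y' then tree_prob k y' * k y' s else 1.

Section Kernel.
Variable k : seq T -> T -> R.
Hypothesis k_ge0 : forall y s, 0 <= k y s.
Hypothesis k_sum1 : forall y, \sum_s k y s = 1.

Lemma tree_prob_ge0 y : 0 <= tree_prob k y.
Proof. by elim: y => //= s y IH; rewrite mulr_ge0. Qed.

Lemma sum_tree_prob_cons y c : \sum_s tree_prob k (s :: y) * c = tree_prob k y * c.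
Proof. by rewrite -mulr_suml -mulr_sumr k_sum1 mulr1. Qed.

Lemma sum_tree_prob n : \sum_(y <- hist n) tree_prob k y = 1.
Proof.
elim: n => [|n IH]; first by rewrite big_seq1.
rewrite big_hist -[RHS]IH; apply: eq_bigr => y _.
by rewrite -mulr_sumr k_sum1 mulr1.
Qed.

End Kernel.

Variables (k k' : seq T -> T -> R) (st ev : pred (seq T)).
Hypothesis k_ge0 : forall y s, 0 <= k y s.
Hypothesis k_sum1 : forall y, \sum_s k y s = 1.
Hypothesis k'_ge0 : forall y s, 0 <= k' y s.
Hypothesis k'_sum1 : forall y, \sum_s k' y s = 1.
Hypothesis k_dom : forall y s, (k y s == 0) = (k' y s == 0).
Hypothesis st_mono : forall y s, st y -> st (s :: y).
Hypothesis ev_st : forall y s, st y -> ev (s :: y) = ev y.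

(* This hybrid law agrees with [k'] on the events known at the stopping time,
   and its density with respect to [k] is frozen from then on. *)
Let kh y s := if st y then k y s else k' y s.

Let kh_ge0 y s : 0 <= kh y s. Proof. by rewrite /kh; case: ifP. Qed.

Let kh_sum1 y : \sum_s kh y s = 1.
Proof. by rewrite /kh; case: (st y). Qed.

(** Log-likelihood ratio of the history cut at the stopping time: the hybrid law has density
    [expR (- stopped_llr y)] with respect to the law of [k]. *)
Fixpoint stopped_llr y : R :=
  if y is s :: y' then
    stopped_llr y' + (if st y' then 0 else ln (k y' s / k' y' s))
  else 0.

Let hybrid_density y :
  0 < tree_prob k y -> tree_prob kh y = tree_prob k y * expR (- stopped_llr y).
Proof.
elim: y => [|s y IH] /=; first by rewrite oppr0 expR0 mulr1.
move=> pk; have [py ks] : 0 < tree_prob k y /\ 0 < k y s.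
  have := pk; rewrite !lt_def mulf_eq0 negb_or => /andP[/andP[-> ->] _].
  by rewrite tree_prob_ge0// k_ge0.
rewrite IH// opprD expRD.
set e := expR (- stopped_llr y); set c := if st y then _ else _.
suff -> : kh y s = k y s * expR (- c) by ring.
rewrite /kh /c; case: ifP => _; first by rewrite oppr0 expR0 mulr1.
have k's : 0 < k' y s by rewrite lt_def -k_dom gt_eqF//= k'_ge0.
rewrite expRN lnK ?posrE ?divr_gt0// invf_div mulrCA divff ?mulr1//.
by rewrite gt_eqF.
Qed.

(** Chain rule: given an unstopped history, the increment of the log-ratio has the divergence of the
    two kernels as its conditional mean; afterwards it is zero. *)
Lemma sum_stopped_llr N :
  \sum_(y <- hist N) tree_prob k y * stopped_llr y =
  \sum_(n < N) \sum_(y <- hist n)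
    tree_prob k y * ((~~ st y)%:R * log_ratio_sum (k y) (k' y)).
Proof.
elim: N => [|N IH]; first by rewrite big_seq1 big_ord0 mulr0.
rewrite big_hist big_ord_recr/= -IH -big_split/=; apply: eq_bigr => y _.
under eq_bigr do rewrite mulrDr.
rewrite big_split/= sum_tree_prob_cons//; congr (_ + _).
under eq_bigr do rewrite -mulrA.
rewrite -mulr_sumr; congr (_ * _).
by case: (st y); rewrite ?mul0r ?mul1r// big1// => s _; rewrite mulr0.
Qed.

Let hybrid_unstopped y : ~~ st y -> tree_prob kh y = tree_prob k' y.
Proof.
elim: y => //= s y IH nst.
have nsty : ~~ st y by apply: contra nst; exact: st_mono.
by rewrite IH// /kh (negbTE nsty).
Qed.

(** Induction on [N]. Below a stopped history the event is settled and both kernels have mass one;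
    below an unstopped one the two laws coincide. *)
Let hybrid_event N :
  \sum_(y <- hist N) tree_prob kh y * (st y && ev y)%:R =
  \sum_(y <- hist N) tree_prob k' y * (st y && ev y)%:R.
Proof.
elim: N => [|N IH]; first by rewrite !big_seq1.
rewrite !big_hist.
have split_st q : (forall y, \sum_s q y s = 1) -> forall y,
    \sum_s tree_prob q (s :: y) * (st (s :: y) && ev (s :: y))%:R =
    tree_prob q y * (st y && ev y)%:R +
    (~~ st y)%:R * \sum_s tree_prob q (s :: y) * (st (s :: y) && ev (s :: y))%:R.
  move=> q1 y; case: (boolP (st y)) => sty; last by rewrite mulr0 add0r mul1r.
  under eq_bigr do rewrite st_mono// ev_st//.
  by rewrite sum_tree_prob_cons// mul0r addr0.
rewrite (eq_bigr _ (fun y _ => split_st _ kh_sum1 y)) big_split/= IH.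
rewrite [RHS](eq_bigr _ (fun y _ => split_st _ k'_sum1 y)) big_split/=.
congr (_ + _); apply: eq_bigr => y _.
case: (boolP (st y)) => sty; first by rewrite !mul0r.
by rewrite !mul1r; apply: eq_bigr => s _; rewrite hybrid_unstopped// /kh (negbTE sty).
Qed.

(** The free parameter [L] replaces a data-processing argument: for an event of probability at most
    [delta] under [k'], the choice [L = ln (1 / delta)] makes the last term at most 1. *)
Lemma change_of_measure N (L : R) :
  L * (\sum_(y <- hist N) tree_prob k y * (st y && ev y)%:R) <=
  \sum_(n < N) \sum_(y <- hist n)
    tree_prob k y * ((~~ st y)%:R * log_ratio_sum (k y) (k' y)) +
  expR L * \sum_(y <- hist N) tree_prob k' y * (st y && ev y)%:R.
Proof.
rewrite -sum_stopped_llr -hybrid_event.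
set E := fun y => (st y && ev y)%:R : R.
(* [1 + x <= expR x] at minus the log-ratio [l], and at [L - l] on the event. *)
have step y : L * (tree_prob k y * E y) + tree_prob k y - tree_prob kh y <=
    tree_prob k y * stopped_llr y + expR L * (tree_prob kh y * E y).
  have [pz|pn] := eqVneq (tree_prob k y) 0.
    rewrite pz !mul0r mulr0 !add0r.
    have := tree_prob_ge0 kh_ge0 y => q0.
    by rewrite (@le_trans _ _ 0) ?oppr_le0// !mulr_ge0 ?expR_ge0// /E ler0n.
  have p_gt0 : 0 < tree_prob k y by rewrite lt_def pn tree_prob_ge0.
  rewrite (hybrid_density p_gt0).
  have e1 := expR_ge1Dx (- stopped_llr y).
  have e2 := expR_ge1Dx (L - stopped_llr y); rewrite expRD in e2.
  move: e1 e2; set x := expR _; set z := expR L; set p := tree_prob k y.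
  set l := stopped_llr y.
  rewrite /E; case: (st y && ev y) => e1 e2; rewrite ?mulr1 ?mulr0.
    rewrite -subr_ge0.
    have -> : p * l + z * (p * x) - (L * p + p - p * x) =
              p * (z * x - (1 + (L - l))) + p * x by ring.
    by rewrite addr_ge0// mulr_ge0 ?expR_ge0 ?(ltW p_gt0)// subr_ge0.
  rewrite -subr_ge0.
  have -> : p * l + 0 - (0 + p - p * x) = p * (x - (1 - l)) by ring.
  by rewrite mulr_ge0 ?(ltW p_gt0)// subr_ge0.
have := @ler_sum R _ (hist N) predT _ _ (fun y _ => step y).
rewrite sumrB !big_split/= -!mulr_sumr !sum_tree_prob//.
by rewrite addrK.
Qed.

End TreeMeasures.

(** * Stochastic matrices, common supports and convexity of the divergence *)

Section StochasticMatrices.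
Variable R : realType.

Definition same_supp m n (A B : 'M[R]_(m, n)) :=
  forall i j, (A i j == 0) = (B i j == 0).

Lemma same_supp_mul m n p (A A' : 'M[R]_(m, n)) (B B' : 'M[R]_(n, p)) :
  (forall i j, 0 <= A i j) -> (forall i j, 0 <= A' i j) ->
  (forall i j, 0 <= B i j) -> (forall i j, 0 <= B' i j) ->
  same_supp A A' -> same_supp B B' -> same_supp (A *m B) (A' *m B').
Proof.
move=> A0 A'0 B0 B'0 AA' BB' i j; rewrite !mxE !psumr_eq0.
- by apply: eq_all => l; rewrite !mulf_eq0 AA' BB'.
- by move=> l _; rewrite mulr_ge0.
- by move=> l _; rewrite mulr_ge0.
Qed.

Lemma prob_row_mul n (p : 'rV[R]_n) (M : 'M[R]_n) :
  prob_row p -> stochastic M -> prob_row (p *m M).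
Proof.
move=> [p0 p1] [M0 M1]; split=> [j|].
  by rewrite mxE sumr_ge0// => i _; rewrite mulr_ge0.
under eq_bigr do rewrite mxE.
rewrite exchange_big/= -[RHS]p1; apply: eq_bigr => i _.
by rewrite -mulr_sumr M1 mulr1.
Qed.

Lemma prob_row_delta n (i : 'I_n) : prob_row (delta_mx 0 i : 'rV[R]_n).
Proof.
split=> [j|]; first by rewrite mxE ler0n.
rewrite (bigD1 i)//= big1 ?addr0 ?mxE ?eqxx// => j ji.
by rewrite mxE eqxx (negbTE ji).
Qed.

Lemma stochasticX n (M : 'M[R]_n.+1) k : stochastic M -> stochastic (M ^+ k).
Proof.
move=> Ms; elim: k => [|k IH].
  split=> [i j|i]; first by rewrite expr0 mxE; case: eqP.
  rewrite expr0 (bigD1 i)//= big1 ?addr0 ?mxE ?eqxx// => j ji.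
  by rewrite mxE eq_sym (negbTE ji).
have rowk i : prob_row (row i (M ^+ k)).
  split=> [j|]; first by rewrite mxE; case: IH.
  by under eq_bigr do rewrite mxE; case: IH.
have rowS i j : (M ^+ k.+1) i j = (row i (M ^+ k) *m M) 0 j.
  by rewrite exprSr -mulmxE -row_mul [RHS]mxE.
split=> [i j|i]; first by rewrite rowS; case: (prob_row_mul (rowk i) Ms).
by under eq_bigr do rewrite rowS; case: (prob_row_mul (rowk i) Ms).
Qed.

Lemma same_suppX n (M M' : 'M[R]_n.+1) k :
  stochastic M -> stochastic M' -> same_supp M M' ->
  same_supp (M ^+ k) (M' ^+ k).
Proof.
move=> Ms M's MM'; elim: k => [|k IH]; first by [].
rewrite !exprSr -!mulmxE; apply: same_supp_mul => //.
- by case: (stochasticX k Ms).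
- by case: (stochasticX k M's).
- by case: Ms.
- by case: M's.
Qed.

(** Convexity: the log-sum inequality in each column, with the common weights [p] cancelling in the
    ratios, then an exchange of sums. Rows of weight zero do not contribute. *)
Lemma log_ratio_sum_mix n (p : 'rV[R]_n) (M M' : 'M[R]_n) (c : R) :
  prob_row p -> stochastic M -> stochastic M' -> same_supp M M' ->
  (forall i, p 0 i != 0 -> log_ratio_sum (M i) (M' i) <= c) ->
  log_ratio_sum ((p *m M) 0) ((p *m M') 0) <= c.
Proof.
move=> [p0 p1] [M0 M1] [M'0 M'1] MM' Mc.
have -> : c = \sum_i p 0 i * c by rewrite -mulr_suml p1 mul1r.
apply: (@le_trans _ _ (\sum_j \sum_i p 0 i * (M i j * ln (M i j / M' i j)))).
  apply: ler_sum => j _.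
  have := @log_sum_ineq R _ (fun i => p 0 i * M i j) (fun i => p 0 i * M' i j).
  rewrite !mxE => /(_ _ _ _)/le_trans; apply=> [i|i|i|].
  - by rewrite mulr_ge0.
  - by rewrite mulr_ge0.
  - by rewrite !mulf_eq0 MM'.
  rewrite /log_ratio_sum ler_sum// => i _.
  have [->|pn] := eqVneq (p 0 i) 0; first by rewrite !mul0r.
  by rewrite -mulrA -mulf_div divff// mul1r.
rewrite exchange_big/=; apply: ler_sum => i _; rewrite -mulr_sumr.
have [->|pn] := eqVneq (p 0 i) 0; first by rewrite !mul0r.
by rewrite ler_wpM2l//; exact: Mc.
Qed.

End StochasticMatrices.

(** * The exponentially twisted transition matrices *)

Section TwistedFamily.
Variables (R : realType) (S : nat) (f : 'I_S.+1 -> R) (P : 'M[R]_S.+1).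
Variables (rho : R -> R) (v : R -> 'cV[R]_S.+1).
Hypothesis P_st : stochastic P.
Hypothesis PF : forall t, perron_frobenius (tilted f P t) (rho t) (v t).

Lemma twisted_stochastic t : stochastic (twisted f P rho v t).
Proof.
have [rho0 v0 ev _] := PF t; split=> [s s'|s].
  rewrite !mxE mulr_ge0 ?divr_ge0 ?mulr_ge0 ?expR_ge0 ?(ltW (v0 _)) ?(ltW rho0)//.
  by case: P_st.
have := congr1 (fun A : 'cV_ _ => A s 0) ev; rewrite !mxE => e.
transitivity ((\sum_j tilted f P t s j * v t j 0) / (rho t * v t s 0)).
  by rewrite mulr_suml; apply: eq_bigr => j _; rewrite !mxE; ring.
by rewrite e divff// mulf_neq0 ?gt_eqF.
Qed.

(** The tilting factors, eigenvalues and eigenvector entries are positive, so the zeros are those of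
    [P] for every parameter. This keeps all divergences finite. *)
Lemma twisted_supp t t' :
  same_supp (twisted f P rho v t) (twisted f P rho v t').
Proof.
move=> i j; rewrite !mxE !mulf_eq0 !invr_eq0 !mulf_eq0 !expR_eq0 !orbF.
have [r1 v1 _ _] := PF t; have [r2 v2 _ _] := PF t'.
by rewrite (gt_eqF r1) (gt_eqF r2) !(gt_eqF (v1 _)) !(gt_eqF (v2 _)).
Qed.

End TwistedFamily.

(** * Divergence of the kernels [Qkernel] *)

Section KernelDivergence.
Variables (R : realType) (K S : nat) (Pt : R -> 'M[R]_S.+1).
Hypothesis Pt_st : forall t, stochastic (Pt t).
Hypothesis Pt_supp : forall t t', same_supp (Pt t) (Pt t').
Implicit Types theta : 'I_K -> R.

Definition arm_divergence theta theta' a d s : R :=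
  log_ratio_sum ((Pt (theta a) ^+ d) s) ((Pt (theta' a) ^+ d) s).

Lemma arm_divergence_ge0 theta theta' a d s :
  0 <= arm_divergence theta theta' a d s.
Proof.
have [p0 p1] := stochasticX d (Pt_st (theta a)).
have [q0 q1] := stochasticX d (Pt_st (theta' a)).
by apply: log_ratio_sum_ge0 => // i; exact: same_suppX.
Qed.

(** The only successor of [z] that the kernel allows when [a] is selected and found in state [s];
    the incremented delays fit since the target allows delays up to [D.+1]. *)
Let next D (z : dstate K S D) (a : 'I_K) (s : 'I_S.+1) : dstate K S D.+1 :=
  ([ffun b => if b == a then s else z.1 b],
   [ffun b => if b == a then inord 1 else inord (z.2 b).+1]).

Let Qkernel_next D theta (z : dstate K S D) a s :
  Qkernel Pt theta z a (next z a s) = (Pt (theta a) ^+ (z.2 a : nat)) (z.1 a) s.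
Proof.
rewrite /Qkernel /next/= !ffunE eqxx inordK// eqxx/=.
case: ifP => // /negP[]; apply/forallP => b; apply/implyP => /negbTE ba.
rewrite !ffunE ba inordK; first by rewrite !eqxx.
by rewrite ltnS.
Qed.

Let Qkernel_neq_next D theta (z : dstate K S D) a (z' : dstate K S D.+1) :
  z' != next z a (z'.1 a) -> Qkernel Pt theta z a z' = 0.
Proof.
rewrite /Qkernel; case: ifP => // /andP[/eqP d1 /forallP dn] /negP[].
apply/eqP; case: z' d1 dn => s' d' /= d1 dn; congr (_, _).
  apply/ffunP => b; rewrite ffunE; case: eqVneq => [->//|ba].
  by have := dn b; rewrite ba => /andP[_ /eqP].
apply/ffunP => b; rewrite ffunE; apply: val_inj => /=.
case: eqVneq => [->|ba]; first by rewrite inordK.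
by have := dn b; rewrite ba => /andP[/eqP-> _]; rewrite inordK// ltnS.
Qed.

(** The sum lives on the image of [next z a], which is parametrized by the observed state; common
    supports rule out the value [+oo]. *)
Lemma KL_Qkernel D theta theta' (z : dstate K S D) a :
  KL (Qkernel Pt theta z a) (Qkernel Pt theta' z a) =
  (arm_divergence theta theta' a (z.2 a) (z.1 a))%:E.
Proof.
rewrite /KL (bigID (fun z' : dstate K S D.+1 => z' == next z a (z'.1 a)))/=.
rewrite [X in (_ + X)%E]big1; last first.
  by move=> z' /Qkernel_neq_next->; rewrite eqxx.
rewrite adde0.
rewrite (reindex_onto (next z a) (fun z' : dstate K S D.+1 => z'.1 a))/=; last first.
  by move=> z' /eqP.
rewrite (eq_bigl predT) => [|s]; last by rewrite !ffunE !eqxx.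
rewrite /arm_divergence /log_ratio_sum -sumEFin; apply: eq_bigr => s _.
rewrite !Qkernel_next.
have /(_ (z.1 a) s) supp :=
  same_suppX (z.2 a) (Pt_st (theta a)) (Pt_st (theta' a)) (Pt_supp _ _).
by rewrite -supp; case: eqP => // ->; rewrite mul0r.
Qed.

End KernelDivergence.

(** * Random variables with finitely many values *)

Section FiniteValued.
Variables (R : realType) (d : measure_display) (Omega : measurableType d).
Variables (I : finType) (Z : Omega -> I).
Hypothesis mZ : forall i, measurable [set w | Z w = i].

Lemma measurable_fin_cases (F : I -> set Omega) :
  (forall i, measurable (F i)) -> measurable [set w | F (Z w) w].
Proof.
move=> mF; rewrite (_ : mkset _ = \bigcup_(i in [set` index_enum I])
    ([set w | Z w = i] `&` F i)).
  apply: fin_bigcup_measurable; first exact: finite_seq.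
  by move=> i _; exact: measurableI.
apply/seteqP; split=> w /=; last by move=> [i _ [/= -> ]].
by move=> FZ; exists (Z w) => //=; rewrite mem_index_enum.
Qed.

Lemma prob_split (Pr : probability Omega R) (C : set Omega) :
  measurable C -> fine (Pr C) = \sum_i fine (Pr (C `&` [set w | Z w = i])).
Proof.
move=> mC; have mCZ i : measurable (C `&` [set w | Z w = i]) by exact: measurableI.
apply: EFin_inj; rewrite -sumEFin fineK ?fin_num_measure//.
under [RHS]eq_bigr do rewrite fineK ?fin_num_measure//.
rewrite (fsbig_seq _ _ (index_enum_uniq I)) -measure_fin_bigcup//=.
- congr (Pr _); apply/seteqP; split=> w /=; last by move=> [i _ []].
  by move=> Cw; exists (Z w) => //=; rewrite mem_index_enum.
- by move=> i j _ _ [w [[_ /= <-] [_ /= <-]]].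
Qed.

End FiniteValued.

(** * Law of the observations under a deterministic sampling rule *)

Section ObservedProcess.
Variables (R : realType) (K S : nat) (d : measure_display).
Variable Omega : measurableType d.
Variables (X : 'I_K -> nat -> Omega -> 'I_S.+1) (A : nat -> Omega -> 'I_K).
Notation T := 'I_S.+1.

(** Only states are recorded, most recent first as in [hist]; the selected arms are recovered from
    them through [sigma]. *)
Fixpoint obs n w : seq T :=
  if n is m.+1 then X (A m.+1 w) m.+1 w :: obs m w else [::].

Lemma size_obs n w : size (obs n w) = n.
Proof. by elim: n => //= n ->. Qed.

Variable sigma : seq T -> 'I_K.
Hypothesis sigmaE : forall n w, A n.+1 w = sigma (obs n w).

Variables (M : 'I_K -> 'M[R]_S.+1) (phi : 'I_K -> 'rV[R]_S.+1).

(* The conditional law of the state of each arm given the observations. *)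
Fixpoint belief (y : seq T) (a : 'I_K) : 'rV[R]_S.+1 :=
  if y is s :: y' then
    if a == sigma y' then delta_mx 0 s else belief y' a *m M a
  else phi a.

(** Conditional law of the next observation: the belief on the arm about to be selected, moved by
    one transition. *)
Definition obs_kernel (y : seq T) : T -> R :=
  (belief y (sigma y) *m M (sigma y)) 0.

Hypothesis M_st : forall a, stochastic (M a).
Hypothesis phi_prob : forall a, prob_row (phi a).

Lemma prob_row_belief y a : prob_row (belief y a).
Proof.
elim: y => //= s y IH; case: ifP => _; first exact: prob_row_delta.
exact: prob_row_mul.
Qed.

Lemma obs_kernel_ge0 y s : 0 <= obs_kernel y s.
Proof.
by have [+ _] := prob_row_mul (prob_row_belief y (sigma y)) (M_st (sigma y)); apply.
Qed.

Lemma obs_kernel_sum1 y : \sum_s obs_kernel y s = 1.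
Proof.
by have [] := prob_row_mul (prob_row_belief y (sigma y)) (M_st (sigma y)).
Qed.

Variable Pr : probability Omega R.
Hypothesis mX : forall a n s, measurable [set w | X a n w = s].
Hypothesis path_law : forall (n : nat) (x : 'I_K -> nat -> T),
  Pr [set w | forall a i, (i <= n)%N -> X a i w = x a i] =
  (\prod_a (phi a 0 (x a 0%N) *
     \prod_(i < n) M a (x a i) (x a i.+1)))%:E.

Notation J := {ffun 'I_K -> T}.
Let Xv n w : J := [ffun a => X a n w].

Let cylinder_measurable n (x : 'I_K -> nat -> T) :
  measurable [set w | forall a i, (i <= n)%N -> X a i w = x a i].
Proof.
rewrite (_ : mkset _ = \bigcap_(i in `I_n.+1)
   \bigcap_(a in [set` index_enum 'I_K]) [set w | X a i w = x a i]).
  apply: fin_bigcap_measurable; first exact: finite_II.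
  by move=> i _; apply: fin_bigcap_measurable => //; exact: finite_seq.
apply/seteqP; split=> w /= H.
  by move=> i /= ilen a _; exact: H.
by move=> a i ilen; apply: H; rewrite /= ?mem_index_enum.
Qed.

Let mXv n x : measurable [set w | Xv n w = x].
Proof.
rewrite (_ : mkset _ = \bigcap_(a in [set` index_enum 'I_K])
   [set w | X a n w = x a]).
  by apply: fin_bigcap_measurable => //; exact: finite_seq.
apply/seteqP; split=> w /=; first by move=> <- a _ /=; rewrite ffunE.
by move=> H; apply/ffunP => a; rewrite ffunE; apply: H; rewrite /= mem_index_enum.
Qed.

Lemma obs_measurable n (c : seq T -> Prop) : measurable [set w | c (obs n w)].
Proof.
elim: n c => [|n IH] c /=.
  have [c0|c0] := pselect (c [::]).
    by rewrite (_ : mkset _ = setT)//; apply/seteqP; split.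
  by rewrite (_ : mkset _ = set0)//; apply/seteqP; split.
have := measurable_fin_cases (@mXv n.+1)
  (fun x : J => IH (fun y => c (x (sigma y) :: y))).
by congr measurable; apply/seteqP; split=> w /=; rewrite !ffunE sigmaE.
Qed.

Let obs_path n w w' : (forall a i, (i <= n)%N -> X a i w = X a i w') ->
  obs n w = obs n w'.
Proof.
elim: n => //= n IH H; have o : obs n w = obs n w'.
  by apply: IH => a i ilen; apply: H; exact: leqW.
by rewrite !sigmaE o H.
Qed.

(** Both events are split along the paths up to [n]. A path either lies in [B] and ends at [x] or
    contributes nothing, and [path_law] at [n.+1] adds one factor for each arm. *)
Let markov n (B : set Omega) (x x' : J) :
  measurable B ->
  (forall w w', (forall a i, (i <= n)%N -> X a i w = X a i w') -> B w -> B w') ->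
  fine (Pr (B `&` [set w | Xv n w = x] `&` [set w | Xv n.+1 w = x'])) =
  fine (Pr (B `&` [set w | Xv n w = x])) * \prod_a M a (x a) (x' a).
Proof.
move=> mB satB.
pose path w : {ffun 'I_n.+1 -> J} := [ffun i : 'I_n.+1 => Xv i w].
have pathE w (xi : {ffun 'I_n.+1 -> J}) : path w = xi <->
    forall a i, (i <= n)%N -> X a i w = xi (inord i) a.
  split=> [<- a i ilen|H]; first by rewrite !ffunE inordK.
  apply/ffunP => i; apply/ffunP => a; rewrite !ffunE H ?inord_val//.
  by rewrite -ltnS.
have mpath xi : measurable [set w | path w = xi].
  have := cylinder_measurable n (fun a i => xi (inord i) a).
  by congr measurable; apply/seteqP; split=> w /pathE.
have mBx := measurableI _ _ mB (mXv n x).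
rewrite (prob_split mpath Pr (measurableI _ _ mBx (mXv n.+1 x'))).
rewrite (prob_split mpath Pr mBx) mulr_suml.
apply: eq_bigr => xi _.
have [[w0 [[Bw0 /= xw0] pw0]]|none] :=
  pselect (exists w, (B `&` [set w | Xv n w = x] `&` [set w | path w = xi]) w);
  last first.
  rewrite (_ : _ `&` _ = set0); last first.
    by apply/seteqP; split=> // w [[[Bw /= xw] _] pw]; apply: none; exists w.
  rewrite [in RHS](_ : _ `&` _ = set0); last first.
    by apply/seteqP; split=> // w [[Bw /= xw] pw]; apply: none; exists w.
  by rewrite measure0 mul0r.
(* The path [xi] is prolonged by [x'], so that the joint event becomes a cylinder up to [n.+1]. *)
pose z a i := if (i <= n)%N then xi (inord i) a else x' a.
have zE a i : (i <= n)%N -> z a i = xi (inord i) a by rewrite /z => ->.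
have xiE a : xi (inord n) a = x a.
  by rewrite -xw0 ffunE -((pathE w0 xi).1 pw0 a n (leqnn n)).
have same w : path w = xi -> B w /\ Xv n w = x.
  move=> pw; have sw a i : (i <= n)%N -> X a i w0 = X a i w.
    by move=> ilen; rewrite ((pathE w0 xi).1 pw0)// ((pathE w xi).1 pw).
  split; first exact: satB Bw0.
  by rewrite -xw0; apply/ffunP => a; rewrite !ffunE sw.
have -> : B `&` [set w | Xv n w = x] `&` [set w | path w = xi] =
    [set w | forall a i, (i <= n)%N -> X a i w = z a i].
  apply/seteqP; split=> w /=.
    by move=> [_ /pathE H] a i ilen; rewrite zE// H.
  move=> H; have pw : path w = xi by apply/pathE => a i ilen; rewrite H ?zE.
  by have [] := same w pw.
have -> : B `&` [set w | Xv n w = x] `&` [set w | Xv n.+1 w = x'] `&`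
      [set w | path w = xi] =
    [set w | forall a i, (i <= n.+1)%N -> X a i w = z a i].
  apply/seteqP; split=> w /=.
    move=> [[_ xw] /pathE H] a i; rewrite leq_eqVlt ltnS => /predU1P[->|ilen].
      by rewrite /z ltnn -xw ffunE.
    by rewrite zE// H.
  move=> H; have pw : path w = xi.
    by apply/pathE => a i ilen; rewrite H ?zE// leqW.
  have [Bw xw] := same w pw; do !split=> //.
  by apply/ffunP => a; rewrite ffunE H// /z ltnn.
rewrite !path_law/= -big_split/=; apply: eq_bigr => a _.
rewrite big_ord_recr/= mulrA; congr (_ * _).
by rewrite /z leqnn ltnn xiE.
Qed.

(** Arms stay conditionally independent given the observations: each observation reveals one arm
    only, and that arm is chosen from past observations. *)
Lemma obs_state_law y (x : J) :
  fine (Pr ([set w | obs (size y) w = y] `&` [set w | Xv (size y) w = x])) =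
  tree_prob obs_kernel y * \prod_a belief y a 0 (x a).
Proof.
elim: y x => [|s y IH] x'.
  rewrite mul1r (_ : _ `&` _ = [set w | forall a i, (i <= 0)%N ->
      X a i w = x' a]); last first.
    apply/seteqP; split=> w /=.
      by move=> [_ <-] a i; rewrite leqn0 => /eqP->; rewrite ffunE.
    by move=> H; split=> //; apply/ffunP => a; rewrite ffunE H.
  rewrite (path_law 0 (fun a _ => x' a))/=; apply: eq_bigr => a _.
  by rewrite big_ord0 mulr1.
set n := size y; set B := [set w | obs n w = y].
have mB : measurable B by exact: (@obs_measurable n (fun z => z = y)).
have BX : fine (Pr (B `&` [set w | Xv n.+1 w = x'])) =
    tree_prob obs_kernel y * \prod_a (belief y a *m M a) 0 (x' a).
  rewrite (prob_split (mXv n) Pr (measurableI _ _ mB (mXv n.+1 x'))).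
  transitivity (\sum_(x : J) tree_prob obs_kernel y *
      \prod_a (belief y a 0 (x a) * M a (x a) (x' a))).
    apply: eq_bigr => x _; rewrite setIAC markov//.
      by rewrite IH -mulrA -big_split.
    by move=> w w' H; rewrite /B/= => <-; apply/esym/obs_path.
  rewrite -mulr_sumr; congr (_ * _).
  rewrite -(bigA_distr_bigA (fun a t => belief y a 0 t * M a t (x' a))).
  by apply: eq_bigr => a _; rewrite mxE.
have step w : obs n.+1 w = s :: y /\ Xv n.+1 w = x' <->
    x' (sigma y) = s /\ (obs n w = y /\ Xv n.+1 w = x').
  rewrite /= sigmaE; split=> [[[<- oy] xw]|[xs [oy xw]]].
    by rewrite oy -xw ffunE.
  by rewrite oy; split=> //; rewrite -xs -xw ffunE.
rewrite /= [X in X `&` _](_ : _ = [set w | obs n.+1 w = s :: y])//.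
(* A selected arm in a state other than [s] gives zero on both sides, its belief being a point mass
   at [s]. *)
have [xs|xs] := eqVneq (x' (sigma y)) s; last first.
  rewrite (_ : _ `&` _ = set0); last first.
    by apply/seteqP; split=> // w /step[xs' _]; rewrite xs' eqxx in xs.
  rewrite measure0 (bigD1 (sigma y))//= eqxx mxE eqxx (negbTE xs).
  by rewrite mul0r mulr0.
rewrite (_ : _ `&` _ = B `&` [set w | Xv n.+1 w = x']); last first.
  by apply/seteqP; split=> w; [move=> /step[_ ]|move=> Bw; apply/step].
rewrite BX (bigD1 (sigma y))//= [in RHS](bigD1 (sigma y))//=.
rewrite eqxx [in RHS]mxE xs !eqxx mul1r mulrA; congr (_ * _).
by apply: eq_bigr => a /negbTE->.
Qed.

Lemma obs_law y :
  fine (Pr [set w | obs (size y) w = y]) = tree_prob obs_kernel y.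
Proof.
have mo := @obs_measurable (size y) (fun z => z = y).
rewrite (prob_split (mXv (size y)) Pr mo).
under eq_bigr do rewrite obs_state_law.
rewrite -mulr_sumr -(bigA_distr_bigA (fun a t => belief y a 0 t)) big1 ?mulr1//.
by move=> a _; case: (prob_row_belief y a).
Qed.

Lemma obs_split n (C : set Omega) : measurable C ->
  fine (Pr C) = \sum_(y <- hist T n) fine (Pr (C `&` [set w | obs n w = y])).
Proof.
move=> mC; elim: n => [|n IH].
  by rewrite big_seq1/= (_ : mkset _ = setT) ?setIT//; apply/seteqP; split.
rewrite big_hist IH; apply: eq_bigr => y _.
pose newest w := head ord0 (obs n.+1 w).
have mnew s : measurable [set w | newest w = s].
  exact: (@obs_measurable n.+1 (fun z => head ord0 z = s)).
have my := @obs_measurable n (fun z => z = y).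
rewrite (prob_split mnew Pr (measurableI _ _ mC my)).
apply: eq_bigr => s _; congr (fine (Pr _)); rewrite -setIA; congr (_ `&` _).
by apply/seteqP; split=> w; rewrite /newest/=; [move=> [-> ->]|move=> [-> ->]].
Qed.

Lemma obs_prob n (c : pred (seq T)) :
  fine (Pr [set w | c (obs n w)]) =
  \sum_(y <- hist T n) tree_prob obs_kernel y * (c y)%:R.
Proof.
rewrite (obs_split n (@obs_measurable n c)) big_seq [RHS]big_seq.
apply: eq_bigr => y /size_hist yn; case: (boolP (c y)) => cy.
  rewrite mulr1 -obs_law yn; congr (fine (Pr _)).
  by apply/seteqP; split=> w /=; [case|move=> ->].
rewrite mulr0 (_ : _ `&` _ = set0) ?measure0//.
by apply/seteqP; split=> // w /= [cw yw]; rewrite yw (negbTE cy) in cw.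
Qed.

End ObservedProcess.

(** * Last selections and delays during and after exploration *)

Section Delays.
Variable K : nat.
Implicit Types (A : nat -> 'I_K) (a : 'I_K).

Lemma last_selection_leq A n a : (last_selection A n.+1 a <= n)%N.
Proof. by apply/bigmax_leqP => i _; rewrite -ltnS. Qed.

Lemma last_selectionS A n a : last_selection A n.+2 a =
  if A n.+1 == a then n.+1 else last_selection A n.+1 a.
Proof.
rewrite /last_selection big_mkcond big_ord_recr/= -big_mkcond/=.
case: eqP => _; last by rewrite maxn0.
apply/maxn_idPr; apply: leq_trans (leqnSn n).
exact: (last_selection_leq A n a).
Qed.

Lemma last_selection_gt0 A n a : explores A -> (K <= n)%N ->
  (0 < last_selection A n.+1 a)%N.
Proof.
move=> /(_ a)[m [[/andP[m1 mK] Am] _]] Kn.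
have mn : (m < n.+1)%N by rewrite ltnS (leq_trans mK).
apply: (leq_trans m1).
by apply: (@leq_bigmax_cond _ _ (fun i : 'I_n.+1 => i : nat) (Ordinal mn));
  rewrite /= m1 Am eqxx.
Qed.

(** Exploration selects each arm once, so the maximum is over an empty set and takes the default 0;
    the delay then counts from the initial law at time 0. *)
Lemma last_selection_first A n : explores A -> (n < K)%N ->
  last_selection A n.+1 (A n.+1) = 0%N.
Proof.
move=> /(_ (A n.+1))[m [_ uniq]] nK; rewrite /last_selection big_pred0// => i.
apply/negbTE/negP => /andP[i0 /eqP Ai].
have mi : m = i.
  by apply: uniq; rewrite i0 (leq_trans _ nK) ?(ltnW (ltn_ord i)).
have mn : m = n.+1 by apply: uniq; rewrite nK.
by have := ltn_ord i; rewrite -mi mn ltnn.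
Qed.

Lemma last_selection_explore A m a : explores A -> (1 <= m <= K)%N ->
  A m = a -> last_selection A K.+1 a = m.
Proof.
move=> /(_ a)[m' [_ uniq]] /andP[m1 mK] Am; apply/eqP; rewrite eqn_leq.
have mK1 : (m < K.+1)%N by rewrite ltnS.
apply/andP; split; last first.
  by apply: (@leq_bigmax_cond _ _ (fun i : 'I_K.+1 => i : nat) (Ordinal mK1));
    rewrite /= m1 Am eqxx.
apply/bigmax_leqP => i /andP[i0 /eqP Ai].
have <- : m' = m by apply: uniq; rewrite m1 mK.
by have <- : m' = i by apply: uniq; rewrite i0 -ltnS ltn_ord.
Qed.

Lemma explores_tperm A a b : explores A -> explores (fun n => tperm a b (A n)).
Proof.
move=> exA c; have [m [[mK Am] uniq]] := exA (tperm a b c).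
exists m; split; first by rewrite mK Am tpermK.
by move=> m' [m'K e]; apply: uniq; split=> //; rewrite -e tpermK.
Qed.

(* During the first [K] updates an arm may be selected after any delay
   [n.+1 <= K] since time 0; relabelling the arms turns the exploration of
   [A] into one after which [a] has that delay. *)
Lemma possible_delay S D A (s : 'I_S.+1) n a :
  explores A -> (K <= D)%N -> (n < K)%N ->
  exists2 z : dstate K S D, z \in possible_upto K S D &
    z.1 a = s /\ (z.2 a : nat) = n.+1.
Proof.
(* After the swap [a] is selected at update [K - n], so its delay at update [K.+1] is [n.+1]. *)
move=> exA KD nK; pose A' m := tperm a (A (K - n)%N) (A m).
have exA' : explores A' by exact: explores_tperm.
have dle b : (delay A' K.+1 b < D.+1)%N.
  have [m [[/andP[m1 mK] A'm] _]] := exA' b.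
  rewrite /delay (last_selection_explore exA' _ A'm) ?m1// ltnS.
  by apply: leq_trans KD; have := leq_sub2l K.+1 m1; rewrite subSS subn0.
exists ([ffun=> s], [ffun b => Ordinal (dle b)]).
  rewrite inE; apply/asboolP; exists A', (fun _ _ => s), K.+1; split=> //=.
    by apply/funext => b; rewrite ffunE.
  by apply/funext => b; rewrite ffunE.
rewrite /= !ffunE/=; split=> //.
rewrite /delay (@last_selection_explore _ (K - n)%N)//.
- by rewrite subSn ?leq_subr// subKn// ltnW.
- by rewrite subn_gt0 nK leq_subr.
- by rewrite /A' tpermR.
Qed.

End Delays.

(** * Beliefs expressed through delays *)

Section BeliefDelay.
Variables (R : realType) (K S : nat) (d : measure_display).
Variable Omega : measurableType d.
Variables (X : 'I_K -> nat -> Omega -> 'I_S.+1) (A : nat -> Omega -> 'I_K).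
Variable sigma : seq 'I_S.+1 -> 'I_K.
Hypothesis sigmaE : forall n w, A n.+1 w = sigma (obs X A n w).
Variable phi : 'I_K -> 'rV[R]_S.+1.

(* The most recent known law of the state of [a], reached at update
   [last_selection]. *)
Definition anchor n w (a : 'I_K) : 'rV[R]_S.+1 :=
  let l := last_selection (A^~ w) n.+1 a in
  if l == 0%N then phi a else delta_mx 0 (X a l w).

Lemma belief_obs (M : 'I_K -> 'M[R]_S.+1) n w a :
  belief sigma M phi (obs X A n w) a =
  anchor n w a *m M a ^+ (n - last_selection (A^~ w) n.+1 a).
Proof.
elim: n => [|n IH].
  have := last_selection_leq (A^~ w) 0 a; rewrite leqn0 /anchor => /eqP->.
  by rewrite expr0 mulmx1.
rewrite /= -sigmaE IH /anchor last_selectionS eq_sym.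
case: eqVneq => [<-|_]; first by rewrite subnn expr0 mulmx1.
by rewrite subSn ?last_selection_leq// exprSr -mulmxE mulmxA.
Qed.

Lemma obs_kernel_obs (M : 'I_K -> 'M[R]_S.+1) n w :
  let a := A n.+1 w in
  obs_kernel sigma M phi (obs X A n w) =
  (anchor n w a *m M a ^+ delay (A^~ w) n.+1 a) 0.
Proof.
rewrite /= /obs_kernel -sigmaE belief_obs -mulmxA mulmxE -exprSr.
by rewrite /delay subSn ?last_selection_leq.
Qed.

Hypothesis phi_prob : forall a, prob_row (phi a).

Lemma prob_row_anchor n w a : prob_row (anchor n w a).
Proof. by rewrite /anchor; case: ifP => // _; exact: prob_row_delta. Qed.

Variable D : nat.
Hypothesis exA : forall w, explores (A^~ w).
Hypothesis delA : forall w n, (K < n)%N ->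
  exists2 z : dstate K S D, z \in possible_upto K S D &
    forall a, z.1 a = last_state (A^~ w) (fun b m => X b m w) n a /\
              (z.2 a : nat) = delay (A^~ w) n a.

(** The arm selected at update 1 has delay [K] at update [K.+1]. *)
Lemma delay_bound (w : Omega) : (K <= D)%N.
Proof.
case K0 : K => [//|k]; rewrite -K0.
have [z _ /(_ (A 1%N w))[_ zd]] := delA w (ltnSn K).
have := ltn_ord (z.2 (A 1%N w)); rewrite zd ltnS /delay.
by rewrite (@last_selection_explore _ _ 1%N)// ?K0// subSS subn0.
Qed.

(** After exploration the anchor is a point mass and the delay constraint supplies the pair. Before,
    any state may carry initial mass, but the delay is [n.+1 <= K <= D] and [possible_delay]
    applies. *)
Lemma anchor_possible n w s :
  let a := A n.+1 w in
  anchor n w a 0 s != 0 ->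
  exists2 z : dstate K S D, z \in possible_upto K S D &
    z.1 a = s /\ (z.2 a : nat) = delay (A^~ w) n.+1 a.
Proof.
rewrite /anchor /=; case: (leqP K n) => [Kn|nK] sa.
  have := sa; rewrite gtn_eqF ?last_selection_gt0//.
  rewrite mxE eqxx/= pnatr_eq0 eqb0 negbK => /eqP->.
  by have [z zp zE] := @delA w n.+1 Kn; exists z => //; exact: zE.
rewrite /delay last_selection_first// subn0.
exact: (possible_delay s (A n.+1 w) (exA w) (delay_bound w) nK).
Qed.

End BeliefDelay.

(** * Tails and expectation of a stopping time *)

Section StoppingTimes.
Variables (R : realType) (d : measure_display) (Omega : measurableType d).
Variables (Pr : probability Omega R) (tau : Omega -> option nat).
Hypothesis mtau : forall n, measurable (stopped_by tau n).

Let stopped_by_mono m n : (m <= n)%N -> stopped_by tau m `<=` stopped_by tau n.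
Proof. by move=> mn w [k ? km]; exists k => //; exact: leq_trans mn. Qed.

Let F (o : option nat) : \bar R :=
  if o is Some n then (n%:R : R)%:E else +oo%E.

Let measurable_stop_time : measurable_fun setT (F \o tau).
Proof.
have mSome n : measurable [set w | tau w = Some n].
  rewrite (_ : mkset _ = stopped_by tau n `\`
      \bigcup_(m in `I_n) stopped_by tau m).
    by apply: measurableD => //; exact: bigcup_measurable.
  apply/seteqP; split=> w /=.
    move=> tw; split; first by exists n.
    by move=> [m /= mn [k]]; rewrite tw => -[<-] nm; rewrite leqNgt mn in nm.
  move=> [[m tw mn] H]; move: mn; rewrite leq_eqVlt => /predU1P[<-//|mn].
  by case: H; exists m => //; exists m.
have mNone : measurable [set w | tau w = None].
  rewrite (_ : mkset _ = ~` \bigcup_n [set w | tau w = Some n]).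
    by apply: measurableC; exact: bigcup_measurable.
  apply/seteqP; split=> w /=; first by move=> tw [n _ /=]; rewrite tw.
  by case tw: (tau w) => [n|//] H; case: H; exists n.
move=> _ Y mY; rewrite setTI.
rewrite (_ : _ @^-1` _ =
    (\bigcup_(n in [set n | Y (F (Some n))]) [set w | tau w = Some n]) `|`
    [set w | Y (F None) /\ tau w = None]).
  apply: measurableU; first exact: bigcup_measurable.
  have [YN|YN] := pselect (Y (F None)).
    by rewrite (_ : mkset _ = [set w | tau w = None])//;
      apply/seteqP; split=> w /= => [[]|].
  by rewrite (_ : mkset _ = set0)//; apply/seteqP; split=> w // [].
apply/seteqP; split=> w /=.
  by case tw: (tau w) => [n|] Yw; [left; exists n|right].
by move=> [[n Yn /= ->]//|[YN ->]].
Qed.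

(** The indicators of being unstopped at the updates below [N] sum to at most the minimum of [N] and
    the stopping time. *)
Lemma sum_tail_le_expectation N :
  (\sum_(n < N) Pr (~` stopped_by tau n) <=
   \int[Pr]_w (if tau w is Some n then (n%:R : R)%:E else +oo))%E.
Proof.
have mS n : measurable (~` stopped_by tau n) by exact: measurableC.
have mI n : measurable_fun setT (fun w => (\1_(~` stopped_by tau n) w : R)%:E).
  by apply/measurable_EFinP; exact: measurable_indic.
rewrite (eq_bigr (fun n : 'I_N =>
    \int[Pr]_w (\1_(~` stopped_by tau n) w)%:E)%E); last first.
  by move=> n _; rewrite integral_indic ?setIT.
rewrite -ge0_integral_sum//.
apply: ge0_le_integral => //.
- by move=> w _; apply: sume_ge0.
- exact: emeasurable_sum.
move=> w _; case tw : (tau w) => [m|]; last by rewrite leey.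
rewrite sumEFin lee_fin.
have le_m k : (\sum_(n < k) (n < m)%N <= minn k m)%N.
  elim: k => [|k IH]; first by rewrite big_ord0.
  rewrite big_ord_recr/=; apply: leq_trans (leq_add IH (leqnn _)) _.
  by case: ltnP; lia.
apply: (@le_trans _ _ (\sum_(n < N) (n < m)%N)%:R).
  rewrite natr_sum; apply: ler_sum => n _; rewrite indicE.
  case: (ltnP n m) => [|mn]; first by case: (_ \in _).
  by rewrite memNset//= => H; apply: H; exists m.
by rewrite ler_nat; apply: (leq_trans (le_m N)); exact: geq_minr.
Qed.

Lemma tail_le_expectation (e : R) N :
  (\int[Pr]_w (if tau w is Some n then (n%:R : R)%:E else +oo) = e%:E)%E ->
  N%:R * fine (Pr (~` stopped_by tau N)) <= e.
Proof.
move=> Ee; have mS n : measurable (~` stopped_by tau n) by exact: measurableC.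
have := sum_tail_le_expectation N; rewrite Ee => /(le_trans _) H.
rewrite -lee_fin; apply: H.
have -> : (N%:R * fine (Pr (~` stopped_by tau N)))%:E =
    (\sum_(n < N) Pr (~` stopped_by tau N))%E.
  rewrite -[X in _ = (\sum_(n < N) X)%E]fineK ?fin_num_measure// sumEFin.
  by rewrite sumr_const card_ord mulr_natl.
apply: lee_sum => n _; apply: le_measure; rewrite ?inE//.
by apply: subsetC; apply: stopped_by_mono; exact: ltnW.
Qed.

End StoppingTimes.

(** * Events of the history as functions of the observed states *)

Section HistoryFactorization.
Variables (K S : nat) (d : measure_display) (Omega : measurableType d).
Variables (X : 'I_K -> nat -> Omega -> 'I_S.+1) (A : nat -> Omega -> 'I_K).

(** The events saturated for agreement of arms and observations form a sigma-algebra containing the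
    generators. *)
Lemma history_saturated n (E : set Omega) w w' : history X A n E ->
  (forall m, (1 <= m <= n)%N ->
     A m w = A m w' /\ X (A m w) m w = X (A m w') m w') ->
  E w -> E w'.
Proof.
pose agree (u u' : Omega) := forall m, (1 <= m <= n)%N ->
  A m u = A m u' /\ X (A m u) m u = X (A m u') m u'.
have agreeC u u' : agree u u' -> agree u' u by move=> H m /H[-> ->].
pose sat (E : set Omega) := forall u u', agree u u' -> E u -> E u'.
suff H : history X A n `<=` sat by move=> hE ag; exact: H hE _ _ ag.
apply: smallest_sub; last first.
  move=> B [m [mn [[a ->]|[s ->]]]] u u' /(_ m mn)[Au Xu] /=.
    by rewrite -Au.
  by rewrite -Xu.
split=> //.
- by move=> B satB u u' uu' [_ nBu]; split=> // Bu'; apply: nBu;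
    apply: satB Bu'; exact: agreeC.
- by move=> B satB u u' uu' [i _ Bu]; exists i => //; exact: satB Bu.
Qed.

Hypothesis predictable :
  forall n a, history X A n [set w | A n.+1 w = a].

(** Equal observed states force equal arms, by induction: the next arm is determined by the history
    so far. *)
Lemma history_obs n (E : set Omega) w w' : history X A n E ->
  obs X A n w = obs X A n w' -> E w -> E w'.
Proof.
move=> hE ow; apply: history_saturated hE _.
suff H : forall k, (k <= n)%N -> obs X A k w = obs X A k w' /\
    forall m, (1 <= m <= k)%N ->
      A m w = A m w' /\ X (A m w) m w = X (A m w') m w'.
  by case: (H n (leqnn n)).
have obs_le k : (k <= n)%N -> obs X A k w = obs X A k w'.
  elim: n ow => [|n IH] /=; first by move=> _; rewrite leqn0 => /eqP->.
  by move=> [Xw ow]; rewrite leq_eqVlt => /predU1P[->/=|/IH->//]; rewrite Xw ow.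
elim=> [|k IH] kn; first by split=> // -[|m].
have [ok IHk] := IH (ltnW kn); split; first exact: obs_le.
move=> m /andP[m1]; rewrite leq_eqVlt => /predU1P[->|mk]; last first.
  by apply: IHk; rewrite m1.
split; last by case: (obs_le _ kn).
have /history_saturated/(_ IHk) : history X A k [set u | A k.+1 u = A k.+1 w].
  exact: predictable.
by move=> /= ->.
Qed.

Lemma sampling_rule (a0 : 'I_K) :
  exists sigma : seq 'I_S.+1 -> 'I_K,
    forall n w, A n.+1 w = sigma (obs X A n w).
Proof.
suff /choice[sigma sigmaE] : forall y : seq 'I_S.+1, exists a, forall w,
    obs X A (size y) w = y -> A (size y).+1 w = a.
  exists sigma => n w; have := sigmaE (obs X A n w) w.
  by rewrite size_obs; apply.
(* Any outcome producing [y] gives the arm; [a0] is a default for lists that never occur. *)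
move=> y; have [[w0 ow0]|none] := pselect (exists w, obs X A (size y) w = y).
  exists (A (size y).+1 w0) => w ow.
  have hE := @predictable (size y) (A (size y).+1 w0).
  by apply: (@history_obs _ _ w0 w hE _ erefl); rewrite ow ow0.
by exists a0 => w ow; case: none; exists w.
Qed.

Variables (tau : Omega -> option nat) (dec : Omega -> 'I_K).
Hypothesis stopping : forall n, history X A n (stopped_by tau n).
Hypothesis deciding : forall a, stopped_history X A tau [set w | dec w = a].

(** Closing a predicate under later observations makes stopping monotone on all lists, even those no
    outcome produces, as [change_of_measure] demands. *)
Fixpoint ever (p : pred (seq 'I_S.+1)) (y : seq 'I_S.+1) : bool :=
  p y || (if y is _ :: y' then ever p y' else false).

Lemma ever_obs p n w :
  ever p (obs X A n w) <-> exists2 m, (m <= n)%N & p (obs X A m w).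
Proof.
split.
  elim: n => [|n IH] /=; first by rewrite orbF => ?; exists 0%N.
  by move=> /orP[?|/IH[m mn ?]]; [exists n.+1|exists m => //; exact: leqW].
elim: n => [|n IH] [m mn pm] /=.
  by move: mn pm; rewrite leqn0 => /eqP->; rewrite /= => ->.
move: mn pm; rewrite leq_eqVlt => /predU1P[->/= -> //|mn pm].
by rewrite IH ?orbT//; exists m.
Qed.

Definition stopped_hist : pred (seq 'I_S.+1) :=
  ever (fun y => `[< exists w, obs X A (size y) w = y /\
                               stopped_by tau (size y) w >]).

Definition decided_hist a : pred (seq 'I_S.+1) :=
  ever (fun y => `[< exists w, [/\ obs X A (size y) w = y,
                       stopped_by tau (size y) w & dec w = a] >]).

Let stopped_byW m n w : (m <= n)%N -> stopped_by tau m w -> stopped_by tau n w.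
Proof. by move=> mn [k ? km]; exists k => //; exact: leq_trans mn. Qed.

Lemma stopped_hist_obs n w : stopped_hist (obs X A n w) <-> stopped_by tau n w.
Proof.
split=> [/ever_obs[m mn /asboolP]|sw].
  rewrite size_obs => -[w' [ow sw]]; apply: stopped_byW mn _.
  exact: history_obs (@stopping m) ow sw.
by apply/ever_obs; exists n => //; apply/asboolP; exists w; rewrite size_obs.
Qed.

Lemma decided_hist_obs a n w :
  decided_hist a (obs X A n w) <-> stopped_by tau n w /\ dec w = a.
Proof.
split=> [/ever_obs[m mn /asboolP]|[sw dw]].
  rewrite size_obs => -[w' [ow sw dw]].
  have [_ /(_ m) hm] := @deciding a.
  have [->] : ([set w | dec w = a] `&` stopped_by tau m) w.
    by apply: history_obs hm ow _; split.
  by move=> sm; split=> //; exact: stopped_byW mn sm.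
by apply/ever_obs; exists n => //; apply/asboolP; exists w; rewrite size_obs.
Qed.

Lemma stopped_hist_cons y s : stopped_hist y -> stopped_hist (s :: y).
Proof. by rewrite /stopped_hist /= => ->; rewrite orbT. Qed.

(** An outcome realizing [s :: y] had already stopped at [y], where its decision was known. *)
Lemma decided_hist_cons a y s : stopped_hist y ->
  decided_hist a (s :: y) = decided_hist a y.
Proof.
move=> sy; rewrite {1}/decided_hist /=; apply/orb_idl => /asboolP[w [ow _ dw]].
have oy : y = obs X A (size y) w by case: ow.
rewrite oy; apply/decided_hist_obs; split=> //.
by apply/stopped_hist_obs; rewrite -oy.
Qed.

End HistoryFactorization.

(** * Information needed for a reliable decision *)

Section InformationBound.
Variables (R : realType) (K S : nat) (d : measure_display).
Variables (Omega : measurableType d) (X : 'I_K -> nat -> Omega -> 'I_S.+1).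
Variables (Pt : R -> 'M[R]_S.+1) (phi : 'I_K -> 'rV[R]_S.+1).
Variables (Pr : ('I_K -> R) -> probability Omega R) (D : nat).
Variable alg : algorithm K Omega.
Hypothesis Pt_st : forall t, stochastic (Pt t).
Hypothesis Pt_supp : forall t t', same_supp (Pt t) (Pt t').
Hypothesis model : restless_model Pt phi Pr X.
Hypothesis adm : admissible X alg.
Hypothesis delA : delay_constrained X D alg.
Notation A := (arm alg).

Definition total_divergence (theta theta' : 'I_K -> R) : R :=
  \sum_(z in possible_upto K S D) \sum_a
    arm_divergence Pt theta theta' a (z.2 a) (z.1 a).

Lemma total_divergence_ge0 theta theta' : 0 <= total_divergence theta theta'.
Proof. by do 2!(apply: sumr_ge0 => ? _); exact: arm_divergence_ge0. Qed.

Let arm_divergence_le_total theta theta' (z : dstate K S D) a :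
  z \in possible_upto K S D ->
  arm_divergence Pt theta theta' a (z.2 a) (z.1 a) <=
  total_divergence theta theta'.
Proof.
move=> zp; rewrite /total_divergence (bigD1 z)//= (bigD1 a)//= -addrA lerDl.
apply: addr_ge0; [|apply: sumr_ge0 => ? _]; apply: sumr_ge0 => ? _;
  exact: arm_divergence_ge0.
Qed.

Variable sigma : seq 'I_S.+1 -> 'I_K.
Hypothesis sigmaE : forall n w, A n.+1 w = sigma (obs X A n w).

Let ker theta := obs_kernel sigma (fun a => Pt (theta a)) phi.
Let phi_prob : forall a, prob_row (phi a). Proof. by case: model. Qed.
Let mX : forall a n s, measurable [set w | X a n w = s].
Proof. by case: model. Qed.

Let belief_ge0 theta y a i s :
  0 <= belief sigma (fun b => Pt (theta b)) phi y a i s.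
Proof.
rewrite ord1.
by have [] := prob_row_belief sigma (fun b => Pt_st (theta b)) phi_prob y a.
Qed.

Let belief_supp theta theta' y a :
  same_supp (belief sigma (fun b => Pt (theta b)) phi y a)
            (belief sigma (fun b => Pt (theta' b)) phi y a).
Proof.
elim: y => //= s y IH; case: ifP => // _.
apply: same_supp_mul => //.
- by case: (Pt_st (theta a)).
- by case: (Pt_st (theta' a)).
Qed.

Let ker_supp theta theta' y s : (ker theta y s == 0) = (ker theta' y s == 0).
Proof.
apply: same_supp_mul.
- exact: belief_ge0.
- exact: belief_ge0.
- by case: (Pt_st (theta (sigma y))).
- by case: (Pt_st (theta' (sigma y))).
- exact: belief_supp.
- exact: Pt_supp.
Qed.

Let exA w : explores (A^~ w). Proof. by case: adm. Qed.

(** The observation law mixes, with the anchor as weights, rows of a matrix power whose exponent is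
    the delay; each row of positive weight comes from a possible pair. *)
Let ker_divergence theta theta' n w :
  log_ratio_sum (ker theta (obs X A n w)) (ker theta' (obs X A n w)) <=
  total_divergence theta theta'.
Proof.
rewrite /ker !(obs_kernel_obs sigmaE).
apply: log_ratio_sum_mix => [||||s sn].
- exact: prob_row_anchor.
- exact: stochasticX.
- exact: stochasticX.
- exact: same_suppX.
have [z zp [<- <-]] := anchor_possible exA delA sn.
exact: arm_divergence_le_total.
Qed.

Let ker_law theta (n : nat) (x : 'I_K -> nat -> 'I_S.+1) :
  Pr theta [set w | forall a i, (i <= n)%N -> X a i w = x a i] =
  (\prod_a (phi a 0 (x a 0%N) *
     \prod_(i < n) Pt (theta a) (x a i) (x a i.+1)))%:E.
Proof. by case: model. Qed.

Let obs_probE theta n (c : pred (seq 'I_S.+1)) :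
  fine (Pr theta [set w | c (obs X A n w)]) =
  \sum_(y <- hist 'I_S.+1 n) tree_prob (ker theta) y * (c y)%:R.
Proof.
exact: (obs_prob sigmaE (fun a => Pt_st (theta a)) phi_prob mX (@ker_law theta)).
Qed.

Let stopped := stopped_hist X A (stop alg).
Let predictable n a : history X A n [set w | A n.+1 w = a].
Proof. by case: adm. Qed.
Let stopping n : history X A n (stopped_by (stop alg) n).
Proof. by case: adm. Qed.
Let deciding a : stopped_history X A (stop alg) [set w | decision alg w = a].
Proof. by case: adm. Qed.

Let stoppedE n :
  stopped_by (stop alg) n = [set w | stopped (obs X A n w)].
Proof.
by apply/seteqP; split=> w /=;
  have [] := stopped_hist_obs predictable stopping n w.
Qed.

Let measurable_stopped n : measurable (stopped_by (stop alg) n).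
Proof.
by rewrite stoppedE; exact: (obs_measurable sigmaE mX n (fun y => stopped y)).
Qed.

Let measurable_decision a : measurable [set w | decision alg w = a].
Proof. by case: (deciding a). Qed.

Variables (theta theta' : 'I_K -> R) (a : 'I_K) (delta e : R).
Hypothesis delta_bounds : 0 < delta <= 4^-1.
Hypothesis Ee : expected_stop (Pr theta) alg = e%:E.
Hypothesis err : (Pr theta [set w | decision alg w <> a] <= delta%:E)%E.
Hypothesis err' : (Pr theta' [set w | decision alg w = a] <= delta%:E)%E.

(** Each unstopped update contributes at most [B], and the expected number of these is at most
    [e]. *)
Let sum_divergence_le N :
  \sum_(n < N) \sum_(y <- hist 'I_S.+1 n) tree_prob (ker theta) y *
    ((~~ stopped y)%:R * log_ratio_sum (ker theta y) (ker theta' y)) <=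
  e * total_divergence theta theta'.
Proof.
set B := total_divergence theta theta'.
apply: (@le_trans _ _
    (\sum_(n < N) fine (Pr theta (~` stopped_by (stop alg) n)) * B)).
  apply: ler_sum => n _.
  rewrite stoppedE (_ : ~` _ = [set w | ~~ stopped (obs X A n w)]); last first.
    by apply/seteqP; split=> w /= => [/negP|/negP].
  rewrite (obs_probE theta n (fun y => ~~ stopped y)) mulr_suml.
  rewrite big_seq [leRHS]big_seq.
  apply: ler_sum => y /size_hist yn; rewrite -mulrA.
  have [[w ow]|none] := pselect (exists w, obs X A (size y) w = y).
    apply: ler_wpM2l; first by apply: tree_prob_ge0 => *; exact: obs_kernel_ge0.
    by apply: ler_wpM2l; rewrite ?ler0n// -ow; exact: ker_divergence.
  (* The divergence bound concerns realized histories only; all others have probability zero. *)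
  rewrite -(obs_law sigmaE (fun a => Pt_st (theta a)) phi_prob mX (@ker_law theta)).
  rewrite (_ : mkset _ = set0) ?measure0 ?mul0r//.
  by apply/seteqP; split=> // w ow; apply: none; exists w.
rewrite -mulr_suml ler_wpM2r ?total_divergence_ge0//.
have := sum_tail_le_expectation (Pr theta) measurable_stopped N.
rewrite -[X in (_ <= X)%E -> _]/(expected_stop (Pr theta) alg) Ee.
rewrite -lee_fin -sumEFin; under [X in _ -> (X <= _)%E]eq_bigr => n _.
  rewrite fineK ?fin_num_measure//; last exact: measurableC.
  over.
by [].
Qed.

Lemma information_bound :
  ln (1 / delta) / 2 - 1 <= e * total_divergence theta theta'.
Proof.
have [d0 d4] := andP delta_bounds.
have e0 : 0 <= e.
  rewrite -lee_fin -Ee; apply: integral_ge0 => w _.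
  by case: (stop alg w) => [n|]; rewrite ?lee_fin ?leey.
(* A horizon at which the tail is at most 1/4 by Markov's inequality; the added 1 keeps it positive
   when [e = 0]. *)
have [N0 N0e] : exists N, 4 * e + 1 <= N%:R.
  by exists (Num.bound (4 * e + 1)); apply/ltW/archi_boundP; lra.
have tailN : fine (Pr theta (~` stopped_by (stop alg) N0)) <= 4^-1.
  have := tail_le_expectation measurable_stopped N0 Ee.
  set p := fine _; have p0 : 0 <= p by exact: fine_ge0.
  move=> H; nra.
set G := fun y => stopped y && decided_hist X A (stop alg) (decision alg) a y.
have GE : [set w | G (obs X A N0 w)] =
    stopped_by (stop alg) N0 `&` [set w | decision alg w = a].
  apply/seteqP; split=> w /=.
    move=> /andP[_ /(decided_hist_obs predictable deciding)].
    by case.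
  move=> H; apply/andP; split.
    by apply/(stopped_hist_obs predictable stopping); case: H.
  exact/(decided_hist_obs predictable deciding).
have mG : measurable [set w | G (obs X A N0 w)].
  by rewrite GE; exact: measurableI.
(* The event fails only by not stopping in time or by a wrong decision, each of probability at most
   1/4. *)
have pG : 2^-1 <= fine (Pr theta [set w | G (obs X A N0 w)]).
  have mD : measurable [set w | decision alg w <> a].
    by rewrite (_ : mkset _ = ~` [set w | decision alg w = a])//; exact: measurableC.
  have mS : measurable (~` stopped_by (stop alg) N0) by exact: measurableC.
  have : (Pr theta (~` [set w | G (obs X A N0 w)]) <=
      Pr theta (~` stopped_by (stop alg) N0) +
      Pr theta [set w | decision alg w <> a])%E.
    apply: (le_trans _ (measureU2 _ _ _)) => //.
    apply: le_measure; rewrite ?inE//; [exact: measurableC|exact: measurableU|].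
    by rewrite GE setCI.
  rewrite probability_setC// => H.
  have {}H := le_trans H (leeD2l _ err); move: H tailN.
  rewrite -[Pr theta (~` _)]fineK ?fin_num_measure//.
  rewrite -[X in (1 - X)%E]fineK ?fin_num_measure// -EFinB -EFinD lee_fin.
  by set p := fine _; set q := fine _; rewrite /=; lra.
have pG' : fine (Pr theta' [set w | G (obs X A N0 w)]) <= delta.
  rewrite -lee_fin fineK ?fin_num_measure//.
  apply: le_trans err'; apply: le_measure; rewrite ?inE// GE.
  exact: subIsetr.
have := change_of_measure
  (obs_kernel_ge0 sigma (fun a => Pt_st (theta a)) phi_prob)
  (obs_kernel_sum1 sigma (fun a => Pt_st (theta a)) phi_prob)
  (obs_kernel_ge0 sigma (fun a => Pt_st (theta' a)) phi_prob)
  (obs_kernel_sum1 sigma (fun a => Pt_st (theta' a)) phi_prob)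
  (ker_supp theta theta')
  (stopped_hist_cons (tau:=stop alg) (X:=X) (A:=A))
  (fun y s => decided_hist_cons predictable stopping deciding a (y:=y) s)
  N0 (ln (1 / delta)).
rewrite -(obs_probE theta N0 G) -(obs_probE theta' N0 G).
rewrite lnK ?posrE ?divr_gt0//.
have := sum_divergence_le N0; rewrite /stopped /ker.
have L0 : 0 <= ln (1 / delta) by apply: ln_ge0; rewrite ler_pdivlMr//; lra.
have q1 : 1 / delta * fine (Pr theta' [set w | G (obs X A N0 w)]) <= 1.
  by rewrite mulrAC ler_pdivrMr// !mul1r.
move: pG L0 q1; set p := fine _; set q := _ * fine _; set l := ln _.
by move=> p2 l0 q1 H1 H2; nra.
Qed.

End InformationBound.

(** * Lower bound on [T_D] from the uniform weights *)

Section Rate.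
Variables (R : realType) (K S : nat) (Pt : R -> 'M[R]_S.+1) (g : R -> R).
Variables (D : nat) (theta : 'I_K -> R).
Hypothesis Pt_st : forall t, stochastic (Pt t).
Hypothesis Pt_supp : forall t t', same_supp (Pt t) (Pt t').

Lemma T_D_ge_uniform (t : R) :
  (0 < #|possible_upto K S D| * K)%N ->
  (forall theta', ALT g theta theta' ->
     t * (#|possible_upto K S D| * K)%:R <= total_divergence Pt D theta theta') ->
  (t%:E <= T_D Pt g D theta)%E.
Proof.
set m := (_ * K)%N => m0 tB; have mR : 0 < m%:R :> R by rewrite ltr0n.
pose nu (z : dstate K S D) (a : 'I_K) : R :=
  if z \in possible_upto K S D then m%:R^-1 else 0.
apply: le_ereal_sup_tmp; eexists.
  exists nu => //; split.
  - by move=> z a; rewrite /nu; case: ifP; rewrite ?invr_ge0.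
  - by move=> z a /negbTE zp; rewrite /nu zp.
  rewrite (eq_bigr (fun=> K%:R / m%:R)) => [|z zp].
    by rewrite sumr_const -[_ *+ #|_|]mulr_natl mulrA -natrM divff// gt_eqF.
  by rewrite /nu zp sumr_const card_ord mulr_natl.
apply: le_ereal_inf_tmp => _ [theta' alt <-].
under eq_bigr => z zp.
  under eq_bigr => a _ do rewrite KL_Qkernel// /nu zp -EFinM.
  rewrite sumEFin; over.
rewrite sumEFin lee_fin; under eq_bigr do rewrite -mulr_sumr.
by rewrite -mulr_sumr mulrC ler_pdivlMr//; exact: tB.
Qed.

End Rate.

(** * The lower bound on the expected stopping time *)

Theorem theorem2 (R : realType) (K S : nat) (f : 'I_S.+1 -> R)
    (P : 'M[R]_S.+1) (gamma : R)
    (rho : R -> R) (v : R -> 'cV[R]_S.+1) (mu : R -> 'rV[R]_S.+1)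
    (dO : measure_display) (Omega : measurableType dO)
    (phi : 'I_K -> 'rV[R]_S.+1)
    (Pr : ('I_K -> R) -> probability Omega R)
    (X : 'I_K -> nat -> Omega -> 'I_S.+1)
    (D : nat) (theta : 'I_K -> R) :
  let Pt := twisted f P rho v in
  let g := arm_cost f Pt mu gamma in
  (forall s, 0 <= f s) ->
  stochastic P ->
  irreducible_mx P ->
  irreducible_attracting P (max_states f) ->
  irreducible_attracting P (min_states f) ->
  (forall t, perron_frobenius (tilted f P t) (rho t) (v t)) ->
  (forall t, stationary (Pt t) (mu t)) ->
  restless_model Pt phi Pr X ->
  (1 <= D)%N ->
  (exists a, best_arm g theta a) ->
  exists C delta0 : R, [/\ 0 < C, 0 < delta0 &
    forall (delta : R), 0 < delta < delta0 ->
    forall alg : algorithm K Omega,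
      admissible X alg ->
      delay_constrained X D alg ->
      delta_PAC Pr g delta alg ->
      (C%:E * ((T_D Pt g D theta)^-1 * (ln (1 / delta))%:E)
        <= expected_stop (Pr theta) alg)%E].
Proof.
move=> Pt g _ P_st _ _ _ PF _ model _ [a best].
have Pt_st := twisted_stochastic P_st PF; have Pt_supp := twisted_supp PF.
set m := (#|possible_upto K S D| * K)%N.
(* Below [expR (- 4)] one has [L > 4], hence [L / 2 - 1 > L / 4], the source of the factor 4. Using
   [m.+1] makes the constant positive before [m] is known to be. *)
exists (4 * m.+1%:R)^-1, (expR (- 4)); split.
- by rewrite invr_gt0 mulr_gt0.
- exact: expR_gt0.
move=> delta /andP[d0 d1] alg adm delA pac.
set L := ln (1 / delta).
have L4 : 4 < L.
  by rewrite /L div1r lnV ?posrE// ltrNr -[ltRHS]expRK ltr_ln ?posrE// expR_gt0.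
have d4 : delta <= 4^-1.
  rewrite (le_trans (ltW d1))// expRN lef_pV2 ?posrE ?expR_gt0//.
  by apply: le_trans (expR_ge1Dx _); lra.
have E0 : (0 <= expected_stop (Pr theta) alg)%E.
  by apply: integral_ge0 => w _; case: (stop alg w) => [n|]; rewrite ?lee_fin ?leey.
case Ee : (expected_stop (Pr theta) alg) E0 => [e||] // E0; last by rewrite leey.
have e0 : 0 <= e by rewrite -lee_fin.
have [w0] : exists w : Omega, True.
  apply: contrapT => none; have : Pr theta setT = 1%E by exact: probability_setT.
  rewrite (_ : setT = set0) ?measure0 => [/esym/eqP|]; first by rewrite onee_eq0.
  by apply/seteqP; split=> // w _; apply: none; exists w.
have m0 : (0 < m)%N.
  have [z zp _] := delA w0 K.+1 (ltnSn K).
  rewrite muln_gt0 (leq_ltn_trans _ (ltn_ord a))// andbT.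
  by apply/card_gt0P; exists z.
have [predictable stopping _ _] := adm.
have [sigma sigmaE] := sampling_rule predictable a.
have info theta' : ALT g theta theta' ->
    L / 2 - 1 <= e * total_divergence Pt D theta theta'.
  move=> [b [b' [bb bb' neq]]]; have [_ err] := pac theta b bb.
  have [_ err'] := pac theta' b' bb'.
  apply: (information_bound Pt_st Pt_supp model adm delA sigmaE (a := b)) => //.
    by rewrite d0.
  (* Deciding for [b] is an error under [theta'], whose best arm is [b']. *)
  apply: le_trans err'; apply: le_measure; rewrite ?inE.
  - by have [_ _ /(_ b)[]] := adm.
  - rewrite (_ : mkset _ = ~` [set w | decision alg w = b'])//.
    by apply: measurableC; have [_ _ /(_ b')[]] := adm.
  - by move=> w /= -> /esym.
have rate t : t * e * m%:R <= L / 2 - 1 -> (t%:E <= T_D Pt g D theta)%E.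
  move=> te; apply: T_D_ge_uniform => // theta' /info le_info.
  have B0 := total_divergence_ge0 D Pt_st Pt_supp theta theta'.
  have e_gt0 : 0 < e.
    by rewrite lt_def e0 andbT; apply/eqP => ez; move: le_info; rewrite ez; lra.
  by rewrite -(ler_pM2l e_gt0); apply: le_trans le_info; rewrite mulrA (mulrC e).
case: (T_D Pt g D theta) rate => [r||] rate.
(* With [e = 0], [rate] would put every real below [T_D], here the finite value [r]. *)
- have e_gt0 : 0 < e.
    rewrite lt_def e0 andbT; apply/eqP => ez.
    have := rate (r + 1); rewrite ez mulr0 mul0r lee_fin => H.
    have : r + 1 <= r by apply: H; lra.
    by lra.
  have mR : 0 < m%:R :> R by rewrite ltr0n.
  have : (L / 2 - 1) / (e * m%:R) <= r.
    rewrite -lee_fin; apply: rate.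
    by rewrite -mulrA divfK// mulf_neq0 ?gt_eqF.
  rewrite ler_pdivrMr ?mulr_gt0// => re.
  have r_gt0 : 0 < r.
    by rewrite -(pmulr_lgt0 _ (mulr_gt0 e_gt0 mR)); lra.
  rewrite inver gt_eqF// -!EFinM lee_fin.
  rewrite mulrC ler_pdivrMr ?mulr_gt0// mulrC ler_pdivrMr//.
  have := mulr_gt0 r_gt0 e_gt0; rewrite -addn1 natrD; nra.
(* When [T_D] is infinite its inverse is 0 and the bound is trivial; the value [-oo] is excluded by
   [rate] at 0. *)
- by rewrite invey mul0e mule0.
- by have /rate : 0 * e * m%:R <= L / 2 - 1 by rewrite !mul0r; lra.
Qed.
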